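(* Let $J\subseteq R=\mathbb{K}[x_1,\ldots,x_n]$ be a $C$-matroidal ideal and let $\mathbb{F}_\bullet$ be any minimal multigraded free resolution of $R/J$. Then for every $h\geq 1$, $$G(SF_h(J))=\mathrm{mdeg}(\mathbb{F}_h).$$
   Context: $\mathbb{K}$ is a field. A squarefree monomial ideal $J\subseteq R$ is $C$-matroidal if it is the cover ideal $J(\mathcal{M})=\bigcap_{F\in\mathcal{B}(\mathcal{M})}(x_i:i\in F)$ of some matroid $\mathcal{M}$ on $[n]$ (equivalently, the Stanley–Reisner ideal of the independence complex of a matroid), where $\mathcal{B}(\mathcal{M})$ is the set of bases. For a squarefree monomial ideal $I$ with minimal primes $\mathfrak q_1,\ldots,\mathfrak q_t$, $I^{(h)}=\bigcap_j\mathfrak q_j^h$, and $SF_h(I)$ is the ideal generated by all squarefree monomials in $I^{(h)}$. $G(I)$ is the set of minimal monomial generators of a monomial ideal $I$. For a multigraded free module $F$, $\mathrm{mdeg}(F)$ is the set of monomials that are the multidegrees of a homogeneous basis of $F$. *)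

(* Defs.v *)
From HB Require Import structures.
From mathcomp Require Import all_boot all_order all_algebra.
From mathcomp Require Import mpoly.
Set Implicit Arguments. Unset Strict Implicit. Unset Printing Implicit Defensive.
Import GRing.Theory.
Local Open Scope ring_scope.

Section Defs.
Variables (K : fieldType) (n : nat).
Local Notation R := {mpoly K[n]}.

Definition is_ideal (I : R -> Prop) : Prop :=
  [/\ I 0, (forall a b, I a -> I b -> I (a + b)) & (forall r a, I a -> I (r * a))].

Definition ideal_gen (S : R -> Prop) : R -> Prop :=
  fun p => exists s : seq (R * R),
    (forall q, q \in s -> S q.2) /\ p = \sum_(q <- s) q.1 * q.2.

Definition prime_ideal (P : R -> Prop) : Prop :=
  [/\ is_ideal P, ~ P 1 & forall a b, P (a * b) -> P a \/ P b].

Definition minimal_prime (I P : R -> Prop) : Prop :=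
  [/\ prime_ideal P, (forall p, I p -> P p) &
      forall Q, prime_ideal Q -> (forall p, I p -> Q p) ->
        (forall p, Q p -> P p) -> forall p, P p -> Q p].

Definition ideal_pow (P : R -> Prop) (h : nat) : R -> Prop :=
  ideal_gen (fun q => exists s : seq R,
    [/\ size s = h, (forall a, a \in s -> P a) & q = \prod_(a <- s) a]).

Definition symbolic_power (I : R -> Prop) (h : nat) : R -> Prop :=
  fun p => forall P, minimal_prime I P -> ideal_pow P h p.

Definition squarefree_mnm (m : 'X_{1..n}) : bool := [forall i, m i <= 1]%N.

Definition SF (I : R -> Prop) (h : nat) : R -> Prop :=
  ideal_gen (fun q => exists m : 'X_{1..n},
    [/\ squarefree_mnm m, q = 'X_[m] & symbolic_power I h 'X_[m]]).

Definition min_gens (I : R -> Prop) (m : 'X_{1..n}) : Prop :=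
  I 'X_[m] /\ forall m' : 'X_{1..n}, I 'X_[m'] -> (m' <= m)%MM -> m' = m.

Definition is_matroid_bases (B : {set {set 'I_n}}) : Prop :=
  B != set0 /\
  forall B1 B2, B1 \in B -> B2 \in B -> forall x, x \in B1 :\: B2 ->
    exists2 y, y \in B2 :\: B1 & (B1 :\ x) :|: [set y] \in B.

Definition var_ideal (F : {set 'I_n}) : R -> Prop :=
  ideal_gen (fun q => exists2 i, i \in F & q = 'X_i).

Definition cover_ideal (B : {set {set 'I_n}}) : R -> Prop :=
  fun p => forall F, F \in B -> var_ideal F p.

(** Data of a multigraded complex of finitely generated free R-modules
    F_i = R^(rk i) (elements are row vectors), the j-th basis element of F_i
    having multidegree x^(deg i j); dif i : F_(i+1) -> F_i (acting on the right)
    and an augmentation F_0 -> R/J sending the k-th basis element to the class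
    of aug k. *)
Record mfree_complex := MFreeComplex {
  rk : nat -> nat;
  bdeg : forall i, 'I_(rk i) -> 'X_{1..n};
  dif : forall i, 'M[R]_(rk i.+1, rk i);
  aug : 'I_(rk 0) -> R }.
Arguments bdeg : clear implicits.
Arguments aug : clear implicits.

Definition is_min_mgraded_free_resolution (J : R -> Prop) (F : mfree_complex) : Prop :=
  ([/\
      (forall i (j : 'I_(rk F i.+1)) (k : 'I_(rk F i)), exists c : K,
          dif F i j k = c *: 'X_[(bdeg F i.+1 j - bdeg F i k)%MM] /\
          (c != 0 -> (bdeg F i k <= bdeg F i.+1 j)%MM)) &
      (forall k, exists c : K, aug F k = c *: 'X_[bdeg F 0 k])] /\
   [/\
      (forall p : R, exists v : 'rV[R]_(rk F 0), J (p - \sum_k v 0 k * aug F k)),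
      (forall v : 'rV[R]_(rk F 0),
          J (\sum_k v 0 k * aug F k) <-> exists w : 'rV[R]_(rk F 1), v = w *m dif F 0),
      (forall i (v : 'rV[R]_(rk F i.+1)),
          v *m dif F i = 0 <-> exists w : 'rV[R]_(rk F i.+2), v = w *m dif F i.+1) &
      (* minimality: all differentials have entries in the maximal ideal (x_1,...,x_n) *)
      (forall i j k, mcoeff 0%MM (dif F i j k) = 0)]).

Definition res_mdeg (F : mfree_complex) (h : nat) : 'X_{1..n} -> Prop :=
  fun m => exists k : 'I_(rk F h), bdeg F h k = m.

End Defs.

(* Main.v *)
(** Write [g A] for the least size of [A :&: F], [F] a basis. A squarefree
    monomial x^A lies in [J^(h)] iff [h <= g A], so the left-hand side consists
    of the sets [A] with [g A = h] such that removing any element lowers [g].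
    In the dual matroid, whose Stanley-Reisner ideal is [J], [g] is the nullity
    and these are the sets of nullity [h] without coloops.

    In multidegree [u] the resolution is an exact complex of K-vector spaces
    spanned by the basis elements of degree [<= u]. For a set [l] of variables
    take the quotient spanned by those degrees that moreover agree with [u] on
    [l]; for [l = supp u] only degree [u] itself remains, and by minimality the
    differential vanishes. The quotient for [(u, l + e)] is the cokernel of the
    injection of the one for [(u - e, l)] into the one for [(u, l)], so
    induction on [l] along the long exact sequences determines in which
    homological degree its homology lives. The combinatorial input is that [g] is
    supermodular. *)

Require Import Defs.
From HB Require Import structures.
From mathcomp Require Import all_boot all_order all_algebra.
From mathcomp Require Import mpoly.
From Stdlib Require Import Classical.
Set Implicit Arguments. Unset Strict Implicit. Unset Printing Implicit Defensive.
Import GRing.Theory.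
Local Open Scope ring_scope.

(** * Cover numbers of matroid bases: monotonicity and supermodularity *)

Section CoverNumber.
Local Open Scope nat_scope.
Variables (T : finType) (B : {set {set T}}).
Implicit Types A F X Y : {set T}.
Hypothesis B0 : B != set0.
Hypothesis exch : forall B1 B2, B1 \in B -> B2 \in B ->
  forall x, x \in B1 :\: B2 ->
    exists2 y, y \in B2 :\: B1 & (B1 :\ x) :|: [set y] \in B.

(* The nullity of A in the dual matroid. *)
Definition cover_number (A : {set T}) : nat :=
  #|A :&: [arg min_(F < odflt set0 [pick F in B] in B) #|A :&: F|]|.

Lemma cover_numberP A :
  exists2 F, F \in B & #|A :&: F| = cover_number A /\
    forall F', F' \in B -> cover_number A <= #|A :&: F'|.
Proof.
rewrite /cover_number; case: arg_minnP => [|F FB Fmin]; last by exists F.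
(* The starting point of the minimum must lie in [B]: the default [set0] never occurs, since [B] is
   nonempty. *)
case: pickP => [F FB //|noF]; have /set0Pn[F FB] := B0.
by have := noF F; rewrite FB.
Qed.

Lemma cover_number_le A F : F \in B -> cover_number A <= #|A :&: F|.
Proof. by move=> FB; have [F' _ [_ /(_ F FB)]] := cover_numberP A. Qed.

Lemma leq_cover_number A h :
  (forall F, F \in B -> h <= #|A :&: F|) <-> h <= cover_number A.
Proof.
split=> [hA | hA F FB]; last exact: leq_trans hA (cover_number_le A FB).
by have [F FB [<- _]] := cover_numberP A; apply: hA.
Qed.

Lemma cover_number0 : cover_number set0 = 0.
Proof. by have [F _ [<- _]] := cover_numberP set0; rewrite set0I cards0. Qed.

Lemma cover_numberS A A' : A \subset A' -> cover_number A <= cover_number A'.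
Proof.
move=> sAA'; have [F FB [<- _]] := cover_numberP A'.
by apply: leq_trans (cover_number_le A FB) _; apply/subset_leq_card/setSI.
Qed.

Lemma cover_numberD1 A x : cover_number A <= (cover_number (A :\ x)).+1.
Proof.
have [F FB [<- _]] := cover_numberP (A :\ x).
apply: leq_trans (cover_number_le A FB) _.
rewrite (cardsD1 x (A :&: F)) -add1n leq_add ?leq_b1 //.
by apply/subset_leq_card/subsetP => y; rewrite !inE => /and3P[-> -> ->].
Qed.

(** An element of [F'] outside [F] would have to be exchanged for one of [F :\: F'], which is
    empty. *)
Lemma basis_sub_eq F F' : F \in B -> F' \in B -> F \subset F' -> F = F'.
Proof.
move=> FB F'B sFF'; apply/eqP; rewrite eqEsubset sFF'; apply/subsetP=> x xF'.
apply: contraT => xF.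
have [|y] := exch F'B FB (x := x); first by rewrite inE xF xF'.
by rewrite inE => /andP[/negP yF yF2]; case: yF; apply: (subsetP sFF').
Qed.

Lemma card_exchange X F x y : x \in F :&: X ->
  #|X :&: (F :\ x :|: [set y])| <= #|X :&: F|.
Proof.
rewrite inE => /andP[xF xX].
rewrite (cardsD1 x (X :&: F)) inE xX xF add1n /=.
apply: leq_trans (_ : #|y |: (X :&: F) :\ x| <= _).
  apply/subset_leq_card/subsetP => z; rewrite !inE.
  by case: (z == y); rewrite ?orbF //= => /and3P[-> -> ->].
by rewrite cardsU1 -[leqRHS]add1n leq_add ?leq_b1.
Qed.

(** The exchange strictly increases the overlap with [F']; this contradicts the maximal choice in
    [cover_number_flag]. *)
Lemma card_exchangeI F F' x y : x \in F :\: F' -> y \in F' :\: F ->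
  #|F :&: F'| < #|(F :\ x :|: [set y]) :&: F'|.
Proof.
rewrite !inE => /andP[xF' xF] /andP[yF yF'].
apply: leq_trans (_ : #|y |: (F :&: F')| <= _).
  by rewrite cardsU1 inE (negbTE yF) /=.
apply/subset_leq_card/subsetP => z; rewrite !inE.
case: (eqVneq z y) => [-> _|_ /= /andP[-> zF']]; first by rewrite yF' orbT.
by rewrite zF' !andbT orbF; apply: contraNneq xF' => <-.
Qed.

(* Take a minimizer for X and one for Y sharing as many elements as possible;
   exchanging inside X shows that they have the same intersection with X. *)
Lemma cover_number_flag X Y : X \subset Y ->
  exists F, [/\ F \in B, #|X :&: F| = cover_number X & #|Y :&: F| = cover_number Y].
Proof.
move=> sXY.
pose ok (p : {set T} * {set T}) := [&& p.1 \in B, p.2 \in B,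
  #|X :&: p.1| <= cover_number X & #|Y :&: p.2| <= cover_number Y].
have [F1 F1B [F1E _]] := cover_numberP X.
have [F2 F2B [F2E _]] := cover_numberP Y.
have ok0 : ok (F1, F2) by rewrite /ok /= F1B F2B F1E F2E !leqnn.
case: (arg_maxnP (fun p : {set T} * {set T} => #|p.1 :&: p.2|) ok0).
case=> F G /and4P[/= FB GB FX GY] FGmax.
have sFG : X :&: F \subset G.
  apply/subsetP=> x; rewrite inE => /andP[xX xF]; apply: contraT => xG.
  have xFG : x \in F :\: G by rewrite inE xG xF.
  have [y yGF F'B] := exch FB GB xFG.
  have := FGmax (F :\ x :|: [set y], G); rewrite /ok /= F'B GB GY andbT /=.
  rewrite (leq_trans (card_exchange _ _) FX) ?inE ?xF // => /(_ isT).
  by rewrite /= leqNgt (card_exchangeI xFG yGF).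
(* Here [X \subset Y] matters: the element removed from [G] lies in [Y], so the exchanged basis is
   still a minimizer for [Y]. *)
have sGF : X :&: G \subset F.
  apply/subsetP=> x; rewrite inE => /andP[xX xG]; apply: contraT => xF.
  have xGF : x \in G :\: F by rewrite inE xG xF.
  have [y yFG G'B] := exch GB FB xGF.
  have := FGmax (F, G :\ x :|: [set y]); rewrite /ok /= G'B FB FX /=.
  rewrite (leq_trans (card_exchange _ _) GY) ?inE ?xG ?(subsetP sXY) //.
  by move/(_ isT); rewrite /= leqNgt setIC (setIC F) (card_exchangeI xGF yFG).
exists G; split=> //; apply/eqP; rewrite eqn_leq cover_number_le // andbT //.
apply: leq_trans FX; apply/subset_leq_card/subsetP => x /[dup].
by rewrite [x \in X :&: F]inE {1}inE => /andP[-> _] /(subsetP sGF).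
Qed.

(** Supermodularity in the form used below. A basis minimizing for both [A' :\ x] and [A] must
    contain [x], so removing [x] from [A] also loses an element of this basis. *)
Lemma cover_number_supmod A' A x : A' \subset A -> x \in A' ->
  cover_number (A' :\ x) < cover_number A' ->
  cover_number A = (cover_number (A :\ x)).+1.
Proof.
move=> sA'A xA' ltA'; apply/eqP; rewrite eqn_leq cover_numberD1 /=.
have [|F [FB FA' <-]] := @cover_number_flag (A' :\ x) A.
  exact: subset_trans (subD1set _ _) sA'A.
have xF : x \in F.
  apply: contraLR ltA' => xF; rewrite -leqNgt -FA'.
  apply: leq_trans (cover_number_le _ FB) _.
  apply/subset_leq_card/subsetP => y; rewrite !inE => /andP[-> yF].
  by rewrite yF !andbT; apply: contraNneq xF => <-.
rewrite (cardsD1 x (A :&: F)) inE (subsetP sA'A) // xF add1n ltnS.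
apply: leq_trans (cover_number_le _ FB) _.
by apply/subset_leq_card/subsetP => y; rewrite !inE => /andP[/andP[-> ->] ->].
Qed.

End CoverNumber.

(** * Linear algebra of subquotient complexes *)

(* Chains supported on the basis elements whose degree satisfies P; when P is
   the difference of two down-sets this is a quotient of two subcomplexes,
   with differential [v |-> v *m D *m dmask P]. *)
Section Subquotients.
Variables (K : fieldType) (T : Type) (le : rel T).
Variables (r : nat -> nat) (deg : forall i, 'I_(r i) -> T).
Variable (D : forall i, 'M[K]_(r i.+1, r i)).
Arguments deg : clear implicits.
Hypothesis D_le : forall i j k, D i j k != 0 -> le (deg i k) (deg i.+1 j).
Hypothesis DD : forall i, D i.+1 *m D i = 0.

Definition dmask (P : pred T) i : 'M[K]_(r i) :=
  diag_mx (\row_k (P (deg i k))%:R).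

Lemma dmaskE P i (v : 'rV[K]_(r i)) k :
  (v *m dmask P i) 0 k = if P (deg i k) then v 0 k else 0.
Proof. by rewrite mul_mx_diag !mxE; case: ifP; rewrite ?mulr1 ?mulr0. Qed.

Lemma dmaskP P i (v : 'rV[K]_(r i)) :
  v *m dmask P i = v <-> forall k, ~~ P (deg i k) -> v 0 k = 0.
Proof.
split=> [<- k /negbTE Pk | vP]; first by rewrite dmaskE Pk.
by apply/rowP=> k; rewrite dmaskE; case: ifPn => // /vP.
Qed.

Lemma dmask_mul P P' i : dmask P i *m dmask P' i = dmask (predI P P') i.
Proof.
apply/row_matrixP=> j; rewrite !rowE mulmxA; apply/rowP=> k.
by rewrite !dmaskE /=; case: (P _); case: (P' _).
Qed.

Lemma eq_dmask P P' i : P =1 P' -> dmask P i = dmask P' i.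
Proof. by move=> eqP; congr diag_mx; apply/rowP=> k; rewrite !mxE eqP. Qed.

Lemma dmask_pred0 i : dmask pred0 i = 0.
Proof. by apply/matrixP=> j k; rewrite !mxE mul0rn. Qed.

(** In degree 0 every chain is a cycle: the augmentation is left out, so exactness at 0 says that
    the cokernel of the last differential vanishes. *)
Definition relative_cycle P i : 'rV[K]_(r i) -> Prop :=
  match i return 'rV[K]_(r i) -> Prop with
  | 0 => fun _ => True
  | i'.+1 => fun v => v *m D i' *m dmask P i' = 0
  end.

Definition exact_at P i : Prop := forall v : 'rV[K]_(r i),
  v *m dmask P i = v -> relative_cycle P v ->
  exists2 w, w *m dmask P i.+1 = w & v = w *m D i *m dmask P i.

Definition convex (P : pred T) :=
  forall x y z, P x -> P z -> le x y -> le y z -> P y.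

Lemma eq_exact_at P P' i : P =1 P' -> exact_at P i -> exact_at P' i.
Proof.
move=> eqP; rewrite /exact_at; case: i => [|i] /= ex v;
  by rewrite -!(eq_dmask _ eqP); exact: ex.
Qed.

(** A path of nonzero entries of [D] that starts and ends in [P] stays in [P] by convexity, so the
    mask in the middle loses nothing and [DD] applies. *)
Lemma boundary_boundary P i : convex P ->
  dmask P i.+2 *m D i.+1 *m dmask P i.+1 *m D i *m dmask P i = 0.
Proof.
move=> cP; apply/row_matrixP=> j; rewrite row0 rowE !mulmxA.
apply/rowP=> k; rewrite dmaskE [RHS]mxE; case: ifP => // Pk; rewrite mxE.
set v := delta_mx 0 j *m _.
transitivity ((v *m (D i.+1 *m D i)) 0 k); last by rewrite DD mulmx0 mxE.
rewrite mulmxA [RHS]mxE; apply: eq_bigr => l _; rewrite dmaskE.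
case: ifPn => // nPl; rewrite mul0r mxE mulr_suml big1 // => m _.
rewrite dmaskE; case: ifPn => Pm; last by rewrite !mul0r.
case: (eqVneq (D i l k) 0) => [->|/D_le lk]; first by rewrite mulr0.
case: (eqVneq (D i.+1 m l) 0) => [->|/D_le ml]; first by rewrite mulr0 mul0r.
by rewrite (cP _ _ _ Pk Pm lk ml) in nPl.
Qed.

(** Says that the chains on [P1] are stable under the differential, so that [P1] gives a subcomplex
    and [P2] the quotient. *)
Lemma dmask_lower (P1 P2 : pred T) i :
  (forall x y, P1 y -> P2 x -> ~~ le x y) ->
  dmask P1 i.+1 *m D i *m dmask P2 i = 0.
Proof.
move=> low; apply/row_matrixP=> j; rewrite row0 rowE !mulmxA.
apply/rowP=> k; rewrite dmaskE [RHS]mxE; case: ifP => // Pk; rewrite mxE.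
rewrite big1 // => m _; rewrite dmaskE; case: ifPn => Pm; last by rewrite mul0r.
case: (eqVneq (D i m k) 0) => [->|/D_le lk]; first by rewrite mulr0.
by have := low _ _ Pm Pk; rewrite lk.
Qed.

(** * The long exact sequence of the subcomplex on [P1] and the quotient on [P2] *)

Variables (P P1 P2 : pred T).
Hypothesis cP : convex P.
Hypothesis splitP : forall x, P x = P1 x (+) P2 x.
Hypothesis disjP : forall x, ~~ (P1 x && P2 x).
Hypothesis lowP : forall x y, P1 y -> P2 x -> ~~ le x y.

Let mP i : dmask P i = dmask P1 i + dmask P2 i.
Proof.
apply/row_matrixP=> j; rewrite !rowE mulmxDr; apply/rowP=> k.
rewrite dmaskE [RHS]mxE !dmaskE splitP; have := disjP (deg i k).
by case: (P1 _); case: (P2 _) => //= _; rewrite ?addr0 ?add0r.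
Qed.

Let m12 i : dmask P1 i *m dmask P2 i = 0.
Proof.
by rewrite dmask_mul -(dmask_pred0 i); apply: eq_dmask => x; apply/negbTE/disjP.
Qed.

Let m21 i : dmask P2 i *m dmask P1 i = 0.
Proof.
rewrite dmask_mul -(dmask_pred0 i); apply: eq_dmask => x /=.
by rewrite andbC; apply/negbTE/disjP.
Qed.

Let mPP (Q : pred T) i : dmask Q i *m dmask Q i = dmask Q i.
Proof. by rewrite dmask_mul; apply: eq_dmask => x /=; rewrite andbb. Qed.

Let mP1 i : dmask P i *m dmask P1 i = dmask P1 i.
Proof. by rewrite mP mulmxDl mPP m21 addr0. Qed.
Let mP2 i : dmask P i *m dmask P2 i = dmask P2 i.
Proof. by rewrite mP mulmxDl mPP m12 add0r. Qed.
Let m1P i : dmask P1 i *m dmask P i = dmask P1 i.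
Proof. by rewrite mP mulmxDr mPP m12 addr0. Qed.
Let m2P i : dmask P2 i *m dmask P i = dmask P2 i.
Proof. by rewrite mP mulmxDr mPP m21 add0r. Qed.

Let D12 i (v : 'rV[K]_(r i.+1)) : v *m dmask P1 i.+1 = v ->
  v *m D i *m dmask P2 i = 0.
Proof. by move=> <-; rewrite -!mulmxA (mulmxA (dmask _ _)) dmask_lower ?mulmx0. Qed.

Let D2P i (v : 'rV[K]_(r i.+1)) : v *m dmask P i.+1 = v ->
  v *m dmask P2 i.+1 *m D i *m dmask P2 i = v *m D i *m dmask P2 i.
Proof.
move=> vP; rewrite -{2}vP mP mulmxDr !mulmxDl [X in X + _]D12 ?add0r //.
by rewrite -mulmxA mPP.
Qed.

Let D1P i (v : 'rV[K]_(r i.+1)) : v *m dmask P1 i.+1 = v ->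
  v *m D i *m dmask P i = v *m D i *m dmask P1 i.
Proof. by move=> /D12 vD; rewrite mP mulmxDr vD addr0. Qed.

Let BB i (v : 'rV[K]_(r i.+2)) : v *m dmask P i.+2 = v ->
  v *m D i.+1 *m dmask P i.+1 *m D i *m dmask P i = 0.
Proof.
move=> <-; have := boundary_boundary i cP; rewrite -!mulmxA => ->.
by rewrite mulmx0.
Qed.

Let BB1 i (v : 'rV[K]_(r i.+2)) : v *m dmask P i.+2 = v ->
  v *m D i.+1 *m dmask P i.+1 *m D i *m dmask P1 i = 0.
Proof. by move=> /BB vB; rewrite -mP1 mulmxA vB mul0mx. Qed.

(** Fill the image of [v] in the quotient and subtract the boundary of this filling; what remains is
    a cycle of [P1], filled in turn. *)
Lemma exact_at_ext i : exact_at P1 i -> exact_at P2 i -> exact_at P i.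
Proof.
move=> ex1 ex2 v vP vc.
have [||w2 w2P w2E] := ex2 (v *m dmask P2 i); first by rewrite -mulmxA mPP.
  case: i v vP vc {ex1 ex2} => //= i v vP vc.
  by rewrite D2P // -mP2 mulmxA vc mul0mx.
have w2PP : w2 *m dmask P i.+1 = w2 by rewrite -w2P -mulmxA m2P.
pose v1 := v - w2 *m D i *m dmask P i.
have v1P2 : v1 *m dmask P2 i = 0.
  by rewrite mulmxBl w2E -!mulmxA mP2 subrr.
have v1P : v1 *m dmask P1 i = v1.
  suff : v1 *m dmask P i = v1 by rewrite mP mulmxDr v1P2 addr0.
  by rewrite mulmxBl vP -(mulmxA _ (dmask P i)) mPP.
have [||w1 w1P w1E] := ex1 v1 => //.
  rewrite /v1; case: i v vP vc {ex1 ex2 v1 v1P v1P2} w2 w2P w2E w2PP => //= i.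
  move=> v vP vc w2 _ _ w2PP.
  by rewrite !mulmxBl BB1 // subr0 -mP1 mulmxA vc mul0mx.
exists (w1 + w2); first by rewrite mulmxDl w2PP -{1}w1P -mulmxA m1P w1P.
by rewrite !mulmxDl D1P // -w1E subrK.
Qed.

(** Stated without exactness of [P1] or [P], so that it also serves in low degrees, where the
    augmentation intervenes. *)
Lemma boundary_quo i (v : 'rV[K]_(r i)) : v *m dmask P2 i = v ->
  (exists2 v1, v1 *m dmask P1 i = v1 &
    exists2 w, w *m dmask P i.+1 = w & v - v1 = w *m D i *m dmask P i) ->
  exists2 w, w *m dmask P2 i.+1 = w & v = w *m D i *m dmask P2 i.
Proof.
move=> vP2 [v1 v1P [w wP wE]].
exists (w *m dmask P2 i.+1); first by rewrite -mulmxA mPP.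
have -> : v = (v - v1) *m dmask P2 i.
  by rewrite mulmxBl vP2 -v1P -mulmxA m12 mulmx0 subr0.
by rewrite wE D2P // -mulmxA mP2.
Qed.

(** From H_i(P) -> H_i(P2) -> H_(i-1)(P1): the boundary of [v] is filled by some [w1] in [P1], and
    [v - w1] is a cycle of [P]. The equation [i = j.+1] makes the condition on [P1] empty at
    [i = 0]. *)
Lemma exact_at_quo i : exact_at P i ->
  (forall j, i = j.+1 -> exact_at P1 j) -> exact_at P2 i.
Proof.
move=> ex ex1 v vP2 vc; apply: boundary_quo => //.
have vP : v *m dmask P i = v by rewrite -vP2 -mulmxA m2P.
suff [v1 v1P v1c] : exists2 v1, v1 *m dmask P1 i = v1 & relative_cycle P (v - v1).
  by exists v1 => //; apply: ex; rewrite // mulmxBl vP -{1}v1P -mulmxA m1P v1P.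
case: i ex ex1 v vP2 vc vP => [|i] ex ex1 v vP2 vc vP.
  by exists 0; rewrite ?mul0mx.
have yE : v *m D i *m dmask P i = v *m D i *m dmask P1 i.
  by rewrite mP mulmxDr vc addr0.
have [||w1 w1P w1E] := ex1 i erefl (v *m D i *m dmask P1 i).
- by rewrite -mulmxA mPP.
- case: i ex ex1 v vP2 vc vP yE => //= i ex ex1 v vP2 vc vP yE.
  by rewrite -yE BB1.
by exists w1 => //=; rewrite !mulmxBl yE w1E D1P // subrr.
Qed.

(** From H_(i+1)(P2) -> H_i(P1) -> H_i(P): a filling [w] of [v] in [P] is a cycle modulo [P1];
    subtracting the boundary of a filling [z] moves it into [P1]. *)
Lemma exact_at_sub i : exact_at P2 i.+1 -> exact_at P i -> exact_at P1 i.
Proof.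
move=> ex2 ex v v1P vc.
have vP : v *m dmask P i = v by rewrite -v1P -mulmxA m1P.
have [||w wP wE] := ex v => //.
  by case: i v vc v1P {vP ex2 ex} => //= i v vc v1P; rewrite D1P.
have [||z zP zE] := ex2 (w *m dmask P2 i.+1).
- by rewrite -mulmxA mPP.
- by rewrite /= D2P // -mP2 mulmxA -wE -v1P -mulmxA m12 mulmx0.
have zPP : z *m dmask P i.+2 = z by rewrite -zP -mulmxA m2P.
pose w1 := w - z *m D i.+1 *m dmask P i.+1.
have w1P : w1 *m dmask P1 i.+1 = w1.
  suff : w1 *m dmask P i.+1 = w1.
    by rewrite mP mulmxDr [X in _ + X](_ : _ = 0) ?addr0 // mulmxBl zE -!mulmxA mP2 subrr.
  by rewrite mulmxBl wP -(mulmxA _ (dmask P i.+1)) mPP.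
exists w1 => //.
by rewrite !mulmxBl BB1 // subr0 -mP1 mulmxA -wE v1P.
Qed.

End Subquotients.

(** * Monomial ideals described by the exponents of their members *)

Section MonomialIdeals.
Variables (K : fieldType) (n : nat).
Local Notation R := {mpoly K[n]}.
Implicit Types (p q : R) (m : 'X_{1..n}) (A F : {set 'I_n}).

Lemma ideal_gen_ideal (S : R -> Prop) : is_ideal (ideal_gen S).
Proof.
split; first by exists [::]; rewrite big_nil.
- move=> _ _ [s [sS ->]] [t [tS ->]]; exists (s ++ t); rewrite big_cat.
  by split=> // q; rewrite mem_cat => /orP[/sS|/tS].
- move=> a _ [s [sS ->]]; exists [seq (a * u.1, u.2) | u <- s]; split.
    by move=> _ /mapP[u /sS ? ->].
  by rewrite big_map mulr_sumr; apply: eq_bigr => q _; rewrite mulrA.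
Qed.

Lemma ideal_gen_mem (S : R -> Prop) q : S q -> ideal_gen S q.
Proof.
by move=> Sq; exists [:: (1, q)]; rewrite big_seq1 mul1r; split=> // ? /[!inE] /eqP->.
Qed.

Lemma ideal_genM (S : R -> Prop) p q : S q -> ideal_gen S (p * q).
Proof. by move/ideal_gen_mem; have [_ _] := ideal_gen_ideal S; apply. Qed.

Lemma is_ideal_sum (I : R -> Prop) (J : eqType) (s : seq J) (f : J -> R) :
  is_ideal I -> (forall j, j \in s -> I (f j)) -> I (\sum_(j <- s) f j).
Proof.
case=> I0 ID _ If; rewrite big_seq; apply: big_ind => //.
Qed.

Definition supp_in (U : 'X_{1..n} -> Prop) p := forall m, m \in msupp p -> U m.

Lemma supp_inX U m : supp_in U 'X_[m] <-> U m.
Proof.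
split=> [|Um m']; first by apply; rewrite msuppX inE.
by rewrite msuppX inE => /eqP->.
Qed.

Lemma supp_inM (U V W : 'X_{1..n} -> Prop) p q :
  (forall m m', U m -> V m' -> W (m + m')%MM) ->
  supp_in U p -> supp_in V q -> supp_in W (p * q).
Proof.
move=> UVW pU qV m /msuppM_le /allpairsP[[m1 m2] /= [m1p m2q ->]].
by apply: UVW; [apply: pU | apply: qV].
Qed.

Lemma supp_in_ideal U : (forall m m', U m -> U (m' + m)%MM) ->
  is_ideal (supp_in U).
Proof.
move=> up; split; first by move=> m; rewrite msupp0.
- by move=> p q pU qU m /msuppD_le; rewrite mem_cat => /orP[/pU|/qU].
- by move=> p q qU; apply: (@supp_inM (fun _ => True) U) => // m m' _; apply: up.
Qed.

Lemma ideal_gen_supp (S : R -> Prop) U p :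
  (forall m m', U m -> U (m' + m)%MM) -> (forall q, S q -> supp_in U q) ->
  ideal_gen S p -> supp_in U p.
Proof.
move=> /supp_in_ideal Uid SU [s [sS ->]]; apply: is_ideal_sum => // q qs.
by have [_ _] := Uid; apply; apply/SU/sS.
Qed.

Definition mset A : 'X_{1..n} := [multinom (i \in A : nat) | i < n].
Definition msup m : {set 'I_n} := [set i | m i != 0%N].
Definition meets F m := [exists i in F, m i != 0%N].

Lemma meetsE F m : meets F m = (msup m :&: F != set0).
Proof.
apply/existsP/set0Pn => -[i]; first by case/andP=> iF mi; exists i; rewrite !inE mi.
by rewrite !inE => /andP[mi iF]; exists i; rewrite iF.
Qed.

Lemma meetsD F m m' : meets F m -> meets F (m' + m)%MM.
Proof.
case/existsP=> i /andP[iF mi]; apply/existsP; exists i.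
by rewrite iF mnmDE addn_eq0 (negbTE mi) andbF.
Qed.

Lemma var_idealE F p : var_ideal F p <-> supp_in (meets F) p.
Proof.
split.
  apply: ideal_gen_supp => [m m'|_ [i iF ->]]; first exact: meetsD.
  by apply/supp_inX/existsP; exists i; rewrite iF mnm1E eqxx.
move=> pF; rewrite [p]mpolyE; apply: is_ideal_sum; first exact: ideal_gen_ideal.
move=> m /pF /existsP[i /andP[iF mi]]; rewrite -mul_mpolyC.
have -> : m = (m - U_(i) + U_(i))%MM by rewrite submK // lep1mP.
by rewrite mpolyXD mulrA; apply: ideal_genM; exists i.
Qed.

Lemma var_ideal_sub F F' :
  (forall p, var_ideal F p -> var_ideal F' p) -> F \subset F'.
Proof.
move=> sub; apply/subsetP=> i iF; have /sub/var_idealE : var_ideal F ('X_i : R).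
  by apply: ideal_gen_mem; exists i.
by move/supp_inX/existsP=> [j]; rewrite mnm1E eqb0 negbK => /andP[jF /eqP->].
Qed.

(* [var_ideal F] is the kernel of the substitution killing the variables in F. *)
Lemma var_ideal_prime F : prime_ideal (@var_ideal K n F).
Proof.
pose lq := [tuple if i \in F then 0 else 'X_i : R | i < n].
have lqX m : 'X_[m] \mPo lq = if meets F m then 0 else 'X_[m] : R.
  rewrite comp_mpolyX; case: ifPn => [/existsP[i /andP[iF mi]] | mF].
    by rewrite (bigD1 i) //= tnth_mktuple iF expr0n (negbTE mi) mul0r.
  rewrite [RHS]mpolyXE_id; apply: eq_bigr => i _; rewrite tnth_mktuple.
  case: ifP => // iF; suff /eqP-> : m i == 0%N by rewrite !expr0.
  by apply: contraR mF => mi; apply/existsP; exists i; rewrite iF.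
have lqE p : var_ideal F p <-> p \mPo lq = 0.
  split=> [/var_idealE pF | p0].
    rewrite comp_mpolyEX big_seq big1 // => m /pF mF.
    by rewrite lqX mF scaler0.
  (* Subtracting the vanishing image of [p] leaves only the terms that meet [F]. *)
  have -> : p = \sum_(m <- msupp p) p@_m *: ('X_[m] - ('X_[m] \mPo lq)).
    under eq_bigr do rewrite scalerBr.
    by rewrite sumrB -mpolyE -comp_mpolyEX p0 subr0.
  apply: is_ideal_sum; first exact: ideal_gen_ideal.
  move=> m _; rewrite lqX; apply/var_idealE=> m'.
  move/msuppZ_le; case: ifP => mF; last by rewrite subrr msupp0.
  by rewrite subr0 msuppX inE => /eqP->.
split; first exact: ideal_gen_ideal.
  by move/lqE/eqP; rewrite comp_mpoly1 oner_eq0.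
move=> a b /lqE; rewrite rmorphM => /eqP; rewrite mulf_eq0.
by case/orP=> /eqP /lqE; [left | right].
Qed.

Lemma ideal_pow_mono (P Q : R -> Prop) h p :
  (forall p, P p -> Q p) -> ideal_pow P h p -> ideal_pow Q h p.
Proof.
move=> PQ [s [sP ->]]; exists s; split=> // q /sP[t [st tP ->]].
by exists t; split=> // a /tP /PQ.
Qed.

(** Each of the [h] factors contributes a variable of [F] to every monomial of the product. *)
Lemma ideal_pow_var F h m : ideal_pow (var_ideal F) h ('X_[m] : R) ->
  (h <= \sum_(i in F) m i)%N.
Proof.
move=> /ideal_gen_supp pow; apply/(supp_inX (fun m => (h <= \sum_(i in F) m i)%N)).
apply: pow => [m1 m2 h1 | _ [s [<- sF ->]]].
  rewrite (eq_bigr (fun i => m2 i + m1 i)%N) ?big_split /=.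
    exact: leq_trans h1 (leq_addl _ _).
  by move=> i _; rewrite mnmDE.
elim: s sF => [|a s IH] sF; first by rewrite big_nil.
rewrite big_cons; apply: (@supp_inM (meets F) (fun m => (size s <= \sum_(i in F) m i)%N)).
- move=> m1 m2 /existsP[i /andP[iF mi]] h2.
  rewrite (eq_bigr (fun i => m1 i + m2 i)%N); last by move=> j _; rewrite mnmDE.
  by rewrite big_split /= -add1n leq_add // (bigD1 i) //= ltn_addr ?lt0n.
- by apply/var_idealE/sF; rewrite mem_head.
- by apply: IH => b bs; apply: sF; rewrite inE bs orbT.
Qed.

(** The first [h] variables of [A :&: F] are the factors; the rest of the monomial is a
    coefficient. *)
Lemma mset_ideal_pow F h A : (h <= #|A :&: F|)%N ->
  ideal_pow (var_ideal F) h ('X_[mset A] : R).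
Proof.
move=> hA; pose t := take h (enum (A :&: F)).
have tAF i : i \in t -> (i \in A) && (i \in F).
  by move/mem_take; rewrite mem_enum inE.
have ut : uniq t by rewrite take_uniq ?enum_uniq.
have tm : ((\sum_(i <- t) U_(i)) <= mset A)%MM.
  apply/mnm_lepP=> j; rewrite mnm_sumE mnmE.
  have -> : \sum_(i <- t) U_(i)%MM j = count_mem j t.
    elim: (t) => [|i s IH]; first by rewrite big_nil.
    by rewrite big_cons IH mnm1E.
  by rewrite count_uniq_mem //; case jt: (j \in t) => //; have /andP[->] := tAF j jt.
have -> : 'X_[mset A] = 'X_[mset A - \sum_(i <- t) U_(i)] * \prod_(i <- t) 'X_i :> R.
  by rewrite (mprodXE _ (fun i => U_(i)%MM)) -mpolyXD submK.
apply: ideal_genM; exists [seq 'X_i : R | i <- t]; split.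
- by rewrite size_map size_take -cardE; case: ltngtP hA.
- move=> _ /mapP[i /tAF /andP[_ iF] ->]; apply: ideal_gen_mem; by exists i.
- by rewrite big_map.
Qed.

Lemma sum_mset A F : (\sum_(i in F) mset A i)%N = #|A :&: F|.
Proof.
rewrite (eq_bigr (fun i => if i \in A then 1 else 0)%N) => [|i _]; last first.
  by rewrite mnmE; case: (i \in A).
rewrite -big_mkcondr sum1_card; apply: eq_card => i.
by rewrite !inE andbC.
Qed.

Lemma mset_le A A' : (mset A <= mset A')%MM = (A \subset A').
Proof.
apply/mnm_lepP/subsetP => [le i iA | sAA' i].
  by have := le i; rewrite !mnmE iA; case: (i \in A').
by rewrite !mnmE; case iA: (i \in A); rewrite ?(sAA' i iA).
Qed.

Lemma mset_inj : injective mset.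
Proof.
by move=> A A' eqA; apply/eqP; rewrite eqEsubset -!mset_le eqA lepm_refl.
Qed.

Lemma msup_mset A : msup (mset A) = A.
Proof. by apply/setP=> i; rewrite inE mnmE; case: (i \in A). Qed.

Lemma mset_msup m : squarefree_mnm m -> mset (msup m) = m.
Proof.
move/forallP=> sq; apply/mnmP=> i; rewrite mnmE inE.
by have := sq i; case: (m i) => [|[]].
Qed.

Lemma mset_squarefree A : squarefree_mnm (mset A).
Proof. by apply/forallP=> i; rewrite mnmE leq_b1. Qed.

Lemma mset_sub1 A i : (mset A - U_(i))%MM = mset (A :\ i).
Proof.
apply/mnmP=> j; rewrite mnmBE mnm1E !mnmE !inE eq_sym.
by case: eqVneq; case: (j \in A).
Qed.

(** * Cover ideals, their symbolic powers and the generators of SF_h *)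

Section Cover.
Variable B : {set {set 'I_n}}.

Definition covered m := [forall F in B, meets F m].

Lemma coveredP m : reflect (forall F, F \in B -> meets F m) (covered m).
Proof. exact: forall_inP. Qed.

Lemma cover_idealE p : cover_ideal B p <-> supp_in covered p.
Proof.
split=> [pB m mp | pB F FB].
  by apply/coveredP=> F FB; have /var_idealE/(_ m mp) := pB F FB.
by apply/var_idealE=> m /pB/coveredP; apply.
Qed.

(** Otherwise each [F] has a variable outside [Q], and the product [g] of these variables lies in
    the cover ideal but not in the prime [Q]. *)
Lemma prime_cover_ideal (Q : R -> Prop) : prime_ideal Q ->
  (forall p, cover_ideal B p -> Q p) ->
  exists2 F, F \in B & forall p, var_ideal F p -> Q p.
Proof.
move=> [Qid Q1 QM] BQ; apply: NNPP => noF.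
have out F : F \in B -> exists2 i, i \in F & ~ Q 'X_i.
  move=> FB; apply: NNPP => noi; apply: noF; exists F => // p [s [sF ->]].
  apply: is_ideal_sum => // q /sF[i iF ->]; have [_ _] := Qid; apply.
  by apply: NNPP => Qi; apply: noi; exists i.
have [g [Qg gB]] : exists g : R, ~ Q g /\
    forall F, F \in enum B -> var_ideal F g.
  have: {subset enum B <= B} by move=> F; rewrite mem_enum.
  elim: (enum B) => [|F s IH] sB; first by exists 1.
  have [F' sF'|g [Qg gs]] := IH; first by apply: sB; rewrite inE sF' orbT.
  have [|i iF Qi] := out F; first by apply: sB; rewrite mem_head.
  exists (g * 'X_i); split=> [/QM[]//|F']; rewrite inE => /orP[/eqP->|/gs F'g].
    by apply: ideal_genM; exists i.
  by have [_ _] := ideal_gen_ideal (fun q : R => exists2 i, i \in F' & q = 'X_i);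
    rewrite mulrC; apply.
by apply/Qg/BQ => F FB; apply: gB; rewrite mem_enum.
Qed.

Hypothesis matB : is_matroid_bases B.
Let B0 : B != set0. Proof. by case: matB. Qed.
Let exch : forall B1 B2, B1 \in B -> B2 \in B ->
  forall x, x \in B1 :\: B2 ->
    exists2 y, y \in B2 :\: B1 & (B1 :\ x) :|: [set y] \in B.
Proof. by case: matB. Qed.

Lemma minimal_prime_cover (F : {set 'I_n}) :
  F \in B -> minimal_prime (cover_ideal B) (@var_ideal K n F).
Proof.
move=> FB; split=> [||Q Qp BQ QF p pF]; first exact: var_ideal_prime.
  by move=> p; apply.
have [F' F'B F'Q] := prime_cover_ideal Qp BQ; suff F'F : F' = F by apply: F'Q; rewrite F'F.
by apply: (basis_sub_eq exch) => //; apply: var_ideal_sub => q /F'Q /QF.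
Qed.

(** Each [var_ideal F] is a minimal prime, and each minimal prime contains some [var_ideal F], hence
    its powers contain those of that ideal. *)
Lemma symbolic_powerE h p :
  symbolic_power (cover_ideal B) h p <->
  forall F, F \in B -> ideal_pow (@var_ideal K n F) h p.
Proof.
split=> [sp F /minimal_prime_cover|pB P [Pp BP Pmin]]; first exact: sp.
have [F FB FP] := prime_cover_ideal Pp BP.
by apply: ideal_pow_mono (pB F FB).
Qed.

Lemma symbolic_power_mset h A :
  symbolic_power (cover_ideal B) h ('X_[mset A] : R) <->
  (h <= cover_number B A)%N.
Proof.
split=> [/symbolic_powerE sA|/leq_cover_number hA].
  by apply/leq_cover_number => // F /sA /ideal_pow_var; rewrite sum_mset.
by apply/symbolic_powerE=> F FB; apply/mset_ideal_pow/hA.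
Qed.

Lemma SF_X h m : SF (cover_ideal B) h ('X_[m] : R) <->
  exists2 A, (mset A <= m)%MM & (h <= cover_number B A)%N.
Proof.
split=> [|[A Am hA]].
  move/ideal_gen_supp=> sf; apply/(supp_inX (fun m => exists2 A,
    (mset A <= m)%MM & (h <= cover_number B A)%N)).
  apply: sf => [m1 m2 [A Am hA] | _ [m' [/mset_msup <- -> /symbolic_power_mset hA]]].
    by exists A => //; apply: lepm_trans Am (lem_addl _ _).
  by apply/supp_inX; exists (msup m'); rewrite ?lepm_refl.
rewrite -(submK Am) mpolyXD; apply: ideal_genM; exists (mset A).
by split; [exact: mset_squarefree | | apply/symbolic_power_mset].
Qed.

(** Since [cover_number] is monotone, minimality under divisibility can be tested by removing one
    variable at a time. *)
Lemma min_gens_SF h m : min_gens (SF (@cover_ideal K n B) h) m <->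
  exists2 A, m = mset A & (h <= cover_number B A)%N /\
    forall x, x \in A -> (cover_number B (A :\ x) < h)%N.
Proof.
split=> [[/SF_X[A Am hA] mmin] | [A -> [hA Amin]]].
  have mA : mset A = m by apply: mmin => //; apply/SF_X; exists A; rewrite ?lepm_refl.
  exists A => //; split=> // x xA; rewrite ltnNge; apply/negP=> hAx.
  have /mset_inj/setP/(_ x) : mset (A :\ x) = mset A.
    rewrite mA; apply: mmin; first by apply/SF_X; exists (A :\ x); rewrite ?lepm_refl.
    by rewrite -mA mset_le subD1set.
  by rewrite !inE eqxx xA.
split=> [|m' /SF_X[A' A'm' hA'] m'A]; first by apply/SF_X; exists A; rewrite ?lepm_refl.
have sA'A : A' \subset A by rewrite -mset_le (lepm_trans A'm').
suff A'A : A = A'.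
  by apply/mnmP=> i; apply/eqP; rewrite eqn_leq (mnm_lepP m'A) A'A (mnm_lepP A'm').
apply/eqP; rewrite eqEsubset sA'A andbT; apply/subsetP=> x xA.
apply: contraT => xA'; have := Amin x xA; rewrite ltnNge (leq_trans hA') //.
by apply: cover_numberS => //; rewrite subsetD1 sA'A.
Qed.

Lemma covered_cover_number m : covered m = (0 < cover_number B (msup m))%N.
Proof.
apply/coveredP/idP => [cm|/leq_cover_number cm F FB].
  by apply/leq_cover_number => // F /cm; rewrite meetsE card_gt0.
by rewrite meetsE -card_gt0; apply: cm.
Qed.

End Cover.
End MonomialIdeals.

(** * Strands of the resolution as complexes over K *)

Section Strands.
Variables (K : fieldType) (n : nat) (B : {set {set 'I_n}}) (F : mfree_complex K n).
Local Notation R := {mpoly K[n]}.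
Hypothesis hF : is_min_mgraded_free_resolution (cover_ideal (K:=K) B) F.
Implicit Types (u v : 'X_{1..n}) (l : seq 'I_n) (e s : 'I_n).

Local Notation deg := (@bdeg K n F _).

(** The monomial of a homogeneous entry is forced, so only its coefficient is kept; one matrix then
    serves all strands through masks. Where [deg k] does not divide [deg j] the exponent is
    truncated, but the coefficient is 0. *)
Definition scalar_dif i : 'M[K]_(rk F i.+1, rk F i) :=
  \matrix_(j, k) (dif F i j k)@_(deg j - deg k)%MM.

Local Notation D := scalar_dif.

Lemma dif_scalar i j k : dif F i j k = D i j k *: 'X_[deg j - deg k].
Proof.
have [[/(_ i j k)[c [dE _]] _] _] := hF.
by rewrite mxE dE mcoeffZ mcoeffX eqxx mulr1.
Qed.

Lemma scalar_dif_le i j k : D i j k != 0 -> (deg k <= deg j)%MM.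
Proof.
have [[/(_ i j k)[c [dE le_c]] _] _] := hF.
by rewrite mxE dE mcoeffZ mcoeffX eqxx mulr1.
Qed.

Lemma scalar_dif_min i j k : deg k = deg j -> D i j k = 0.
Proof.
move=> kj; have [_ [_ _ _ /(_ i j k)]] := hF.
rewrite dif_scalar kj mcoeffZ mcoeffX (_ : deg j - deg j = 0)%MM ?eqxx ?mulr1 //.
by apply/mnmP=> t; rewrite mnmBE subnn mnm0E.
Qed.

Definition below u : pred 'X_{1..n} := fun v => (v <= u)%MM.
Local Notation supp_below u w := (w%R *m dmask K (@bdeg K n F) (below u) _ = w%R).

Lemma supp_belowP u i (v : 'rV[K]_(rk F i)) k :
  supp_below u v -> v 0 k != 0 -> (deg k <= u)%MM.
Proof. by move/dmaskP/(_ k) => vk; apply: contraNT => /vk/eqP. Qed.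

Lemma below_scalar_dif u i (v : 'rV[K]_(rk F i.+1)) :
  supp_below u v -> supp_below u (v *m D i).
Proof.
move=> vu; apply/dmaskP=> k ku; rewrite mxE big1 // => j _.
case: (eqVneq (v 0 j) 0) => [->|/(supp_belowP vu) ju]; first by rewrite mul0r.
case: (eqVneq (D i j k) 0) => [->|/scalar_dif_le kj]; first by rewrite mulr0.
by rewrite /below (lepm_trans kj) in ku.
Qed.

Definition homog_lift u i (v : 'rV[K]_(rk F i)) : 'rV[R]_(rk F i) :=
  \row_k (v 0 k *: 'X_[u - deg k]).

(** The component of degree [u] of an arbitrary vector, a left inverse of [homog_lift]; it makes
    homogeneous the preimages that exactness over R provides. *)
Definition homog_part u i (V : 'rV[R]_(rk F i)) : 'rV[K]_(rk F i) :=
  \row_k (if (deg k <= u)%MM then (V 0 k)@_(u - deg k)%MM else 0).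

Lemma homog_part_below u i (V : 'rV[R]_(rk F i)) : supp_below u (homog_part u V).
Proof. by apply/dmaskP=> k /negbTE ku; rewrite mxE; move: ku; rewrite /below => ->. Qed.

Lemma homog_liftK u i (v : 'rV[K]_(rk F i)) :
  supp_below u v -> homog_part u (homog_lift u v) = v.
Proof.
move=> vu; apply/rowP=> k; rewrite !mxE mcoeffZ mcoeffX eqxx mulr1.
by case: ifPn => // ku; have /dmaskP-> := vu.
Qed.

Lemma homog_lift0 u i : homog_lift u (0 : 'rV[K]_(rk F i)) = 0.
Proof. by apply/rowP=> k; rewrite !mxE scale0r. Qed.

Lemma sub_chain u v x : (v <= x)%MM -> (x <= u)%MM -> (u - x + (x - v) = u - v)%MM.
Proof.
move=> /mnm_lepP vx /mnm_lepP xu; apply/mnmP=> i.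
by rewrite mnmDE !mnmBE addnBA // subnK.
Qed.

Lemma homog_lift_dif u i (v : 'rV[K]_(rk F i.+1)) : supp_below u v ->
  homog_lift u v *m dif F i = homog_lift u (v *m D i).
Proof.
move=> vu; apply/rowP=> k; rewrite !mxE scaler_suml; apply: eq_bigr => j _.
rewrite mxE dif_scalar -scalerAl -scalerAr scalerA -mpolyXD.
case: (eqVneq (v 0 j) 0) => [->|/(supp_belowP vu) ju]; first by rewrite !mul0r !scale0r.
case: (eqVneq (D i j k) 0) => [->|/scalar_dif_le kj]; first by rewrite !mulr0 !scale0r.
by rewrite sub_chain.
Qed.

Lemma homog_part_dif u i (V : 'rV[R]_(rk F i.+1)) :
  homog_part u (V *m dif F i) = homog_part u V *m D i.
Proof.
apply/rowP=> k; rewrite [LHS]mxE; case: ifPn => [ku | ku]; last first.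
  by have /dmaskP-> := below_scalar_dif (homog_part_below u V).
rewrite !mxE raddf_sum; apply: eq_bigr => j _ /=; rewrite [homog_part u V 0 j]mxE.
rewrite dif_scalar -scalerAr mcoeffZ mulrC.
case: (eqVneq (D i j k) 0) => [->|/scalar_dif_le kj]; first by rewrite !mulr0.
congr (_ * _); case: ifP => ju.
  by rewrite -(sub_chain kj ju) addmC mcoeffMX.
(* If the product had a term of exponent [u - deg k], then [deg j] would divide [u]. *)
apply: contraFeq ju; rewrite -mcoeff_msupp => /msuppM_le /allpairsP[[m1 m2] /= [_]].
rewrite msuppX inE => /eqP-> /mnmP E; apply/mnm_lepP=> t.
have := E t; rewrite mnmBE mnmDE mnmBE => Et.
by rewrite -(subnK (mnm_lepP ku t)) Et -addnA subnK ?leq_addl ?(mnm_lepP kj).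
Qed.

Lemma strand_exact u i (v : 'rV[K]_(rk F i.+1)) : supp_below u v ->
  v *m D i = 0 -> exists2 w, supp_below u w & v = w *m D i.+1.
Proof.
move=> vu v0; have [_ [_ _ /(_ i (homog_lift u v))[exF _] _]] := hF.
have [|W WE] := exF; first by rewrite homog_lift_dif // v0 homog_lift0.
exists (homog_part u W); first exact: homog_part_below.
by rewrite -homog_part_dif -WE homog_liftK.
Qed.

(** Tested on one basis vector, lifted to the strand of its own degree, where [dif F] composes to
    zero by exactness. *)
Lemma scalar_dif_dif i : D i.+1 *m D i = 0.
Proof.
apply/row_matrixP=> j; rewrite row0 row_mul.
have ju : supp_below (deg j) (row j (D i.+1)).
  by apply/dmaskP=> k; rewrite mxE; apply/contraNeq => /scalar_dif_le.
have du : supp_below (deg j) (delta_mx 0 j : 'rV[K]_(rk F i.+2)).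
  apply/dmaskP=> l; rewrite mxE eqxx /=; case: eqVneq => // ->.
  by rewrite /below lepm_refl.
rewrite -(homog_liftK (below_scalar_dif ju)) -homog_lift_dif //.
have [_ [_ _ exF _]] := hF; rewrite (exF _ _).2.
  by apply/rowP=> k; rewrite !mxE raddf0 if_same.
by exists (homog_lift (deg j) (delta_mx 0 j)); rewrite homog_lift_dif // -rowE.
Qed.

Definition scalar_aug (v : 'rV[K]_(rk F 0)) : K :=
  \sum_k v 0 k * (aug k)@_(deg k).

Lemma aug_scalar k : aug k = (aug k)@_(deg k) *: 'X_[deg k] :> R.
Proof.
have [[_ /(_ k)[c augE]] _] := hF.
by rewrite augE mcoeffZ mcoeffX eqxx mulr1.
Qed.

Lemma homog_lift_aug u (v : 'rV[K]_(rk F 0)) : supp_below u v ->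
  \sum_k homog_lift u v 0 k * aug k = scalar_aug v *: 'X_[u].
Proof.
move=> vu; rewrite scaler_suml; apply: eq_bigr => k _.
rewrite mxE [aug k in LHS]aug_scalar -scalerAl -scalerAr scalerA -mpolyXD.
case: (eqVneq (v 0 k) 0) => [->|/(supp_belowP vu) ku]; first by rewrite !mul0r !scale0r.
by rewrite submK.
Qed.

Lemma cover_ideal_ZX u (c : K) : cover_ideal B (c *: 'X_[u]) <-> c = 0 \/ covered B u.
Proof.
split=> [/cover_idealE cu | [-> | cu]].
- case: (eqVneq c 0) => [|c0]; [by left | right; apply: cu].
  by rewrite mcoeff_msupp mcoeffZ mcoeffX eqxx mulr1.
- by apply/cover_idealE=> m; rewrite scale0r msupp0.
- by apply/cover_idealE=> m /msuppZ_le; rewrite msuppX inE => /eqP->.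
Qed.

(** In degree [u] the module R/J is 0 if [u] is covered and K otherwise, whence the two
    alternatives. *)
Lemma strand_augP u (v : 'rV[K]_(rk F 0)) : supp_below u v ->
  (exists2 w, supp_below u w & v = w *m D 0) <-> scalar_aug v = 0 \/ covered B u.
Proof.
move=> vu; have [_ [_ /(_ (homog_lift u v))[exl exr] _ _]] := hF.
rewrite -cover_ideal_ZX -homog_lift_aug //; split=> [[w wu vE] | /exl[W WE]].
  by apply: exr; exists (homog_lift u w); rewrite homog_lift_dif // -vE.
exists (homog_part u W); first exact: homog_part_below.
by rewrite -homog_part_dif -WE homog_liftK.
Qed.

Lemma strand_aug_surj u : ~~ covered B u ->
  exists2 v, supp_below u v & scalar_aug v = 1.
Proof.
move=> cu; have [_ [/(_ 'X_[u])[V] VE _ _ _]] := hF.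
exists (homog_part u V); first exact: homog_part_below.
have /eqP : ('X_[u] - \sum_k V 0 k * aug k)@_u = 0.
  by apply/eqP; rewrite mcoeff_eq0; apply: contra cu => /(cover_idealE _ _).1; apply.
rewrite mcoeffB mcoeffX eqxx subr_eq0 => /eqP sumE.
apply: etrans (esym sumE); rewrite raddf_sum; apply: eq_bigr => k _ /=; rewrite mxE [aug k in RHS]aug_scalar.
rewrite -scalerAr mcoeffZ mulrC.
congr (_ * _); case: ifPn => ku; first by rewrite -[in RHS](submK ku) addmC mcoeffMX.
apply/esym; apply: contraNeq ku; rewrite -mcoeff_msupp => /msuppM_le /allpairsP[[m1 m2] /= [_]].
by rewrite msuppX inE => /eqP-> ->; apply: lem_addl.
Qed.

(* For l = supp u, the span of the basis elements with degree in [slice u l]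
   has homology Tor(R/J, K) in degree u. *)
Definition slice u l : pred 'X_{1..n} :=
  fun v => (v <= u)%MM && all (fun i => v i == u i) l.

Local Notation exact u l i := (exact_at (@bdeg K n F) D (slice u l) i).

Lemma slice_nil u : slice u [::] =1 below u.
Proof. by move=> v; rewrite /slice andbT. Qed.

Lemma dmask_slice_nil u i :
  dmask K (@bdeg K n F) (slice u [::]) i = dmask K (@bdeg K n F) (below u) i.
Proof. exact/eq_dmask/slice_nil. Qed.

Lemma slice_convex u l : convex (@lem n) (slice u l).
Proof.
move=> x y z /andP[xu /allP xl] /andP[zu _] xy yz.
rewrite /slice (lepm_trans yz zu); apply/allP=> i il.
rewrite eqn_leq (mnm_lepP (lepm_trans yz zu)) -(eqP (xl i il)).
exact: (mnm_lepP xy).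
Qed.

(** The exponent at [e] is either below [u e], giving the slice of [u - U_(e)], or equal to it. As
    [e] is not in [l], both slices impose the same condition on [l]. *)
Lemma slice_step u l e v : e \notin l -> u e != 0%N ->
  slice u l v = slice (u - U_(e))%MM l v (+) slice u (e :: l) v.
Proof.
move=> el ue; rewrite /slice /=.
have -> : all (fun i => v i == (u - U_(e))%MM i) l = all (fun i => v i == u i) l.
  apply: eq_in_all => i il; rewrite mnmBE mnm1E; case: (eqVneq e i) => [ei|_].
    by rewrite -ei (negbTE el) in il.
  by rewrite subn0.
case: (all _ _); rewrite ?andbF // !andbT.
have -> : (v <= u - U_(e))%MM = (v <= u)%MM && (v e < u e)%N.
  apply/mnm_lepP/andP => [vu | [/mnm_lepP vu ve] i].
    split; first by apply/mnm_lepP=> i; rewrite (leq_trans (vu i)) // mnmBE leq_subr.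
    by have := vu e; rewrite mnmBE mnm1E eqxx -ltnS subn1 prednK // lt0n.
  rewrite mnmBE mnm1E; case: (eqVneq e i) => [<-|_]; last by rewrite subn0 vu.
  by rewrite subn1 -ltnS prednK // lt0n.
case vu: (v <= u)%MM => //=.
by have := mnm_lepP vu e; rewrite leq_eqVlt; case: ltngtP.
Qed.

Lemma slice_disj u l e v : u e != 0%N ->
  ~~ (slice (u - U_(e))%MM l v && slice u (e :: l) v).
Proof.
move=> ue; apply/negP=> /andP[/andP[/mnm_lepP/(_ e) vu _] /and3P[_ /eqP ve _]].
by move: vu; rewrite ve mnmBE mnm1E eqxx subn1 -ltnS prednK ?ltnn // lt0n.
Qed.

Lemma slice_low u l e x y : u e != 0%N ->
  slice (u - U_(e))%MM l y -> slice u (e :: l) x -> ~~ (x <= y)%MM.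
Proof.
move=> ue /andP[/mnm_lepP/(_ e) yu _] /and3P[_ /eqP xe _].
apply/negP=> /mnm_lepP/(_ e) xy; move: (leq_trans xy yu).
by rewrite xe mnmBE mnm1E eqxx subn1 -ltnS prednK ?ltnn // lt0n.
Qed.

Lemma exact_at_slice_mem u l e i : (e \in l) || (u e == 0%N) ->
  exact u l i -> exact u (e :: l) i.
Proof.
move=> el; apply: eq_exact_at => v; rewrite /slice /=.
case: (all _ l) / allP => [vl|_]; last by rewrite !andbF.
case vu: (v <= u)%MM => //=; rewrite andbT; apply/esym.
case/orP: el => [/vl // | /eqP ue].
by have := mnm_lepP vu e; rewrite ue leqn0.
Qed.

(** * The long exact sequence for one more variable in a slice *)

Section Step.
Variables (u : 'X_{1..n}) (l : seq 'I_n) (e : 'I_n).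
Hypotheses (el : e \notin l) (ue : u e != 0%N).
Let splitP v := slice_step v el ue.
Let disjP v := slice_disj l v ue.
Let lowP x y := @slice_low u l e x y ue.

Let M l u i := dmask K (@bdeg K n F) (slice u l) i.

Lemma slice_boundary_quo i (v : 'rV[K]_(rk F i)) : v *m M (e :: l) u i = v ->
  (exists2 v1, v1 *m M l (u - U_(e))%MM i = v1 &
    exists2 w, w *m M l u i.+1 = w & v - v1 = w *m D i *m M l u i) ->
  exists2 w, w *m M (e :: l) u i.+1 = w & v = w *m D i *m M (e :: l) u i.
Proof. exact: (boundary_quo scalar_dif_le splitP disjP lowP). Qed.

Lemma exact_slice_quo i : exact u l i ->
  (forall j, i = j.+1 -> exact (u - U_(e))%MM l j) -> exact u (e :: l) i.
Proof.
exact: (exact_at_quo scalar_dif_le scalar_dif_dif (@slice_convex u l) splitP disjP lowP).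
Qed.

Lemma exact_slice_ext i : exact (u - U_(e))%MM l i -> exact u (e :: l) i ->
  exact u l i.
Proof.
exact: (exact_at_ext scalar_dif_le scalar_dif_dif (@slice_convex u l) splitP disjP lowP).
Qed.

Lemma exact_slice_sub i : exact u (e :: l) i.+1 -> exact u l i ->
  exact (u - U_(e))%MM l i.
Proof.
exact: (exact_at_sub scalar_dif_le scalar_dif_dif (@slice_convex u l) splitP disjP lowP).
Qed.

End Step.

(* s is a coloop of the interval [0, u], or u s >= 2. *)
Definition removable u s := u s != 0%N /\
  forall v, (v <= u)%MM -> v s = u s -> covered B v = covered B (v - U_(s))%MM.

(** * Homology of full strands, and vanishing in the presence of a removable variable *)

Lemma strand_exact_at u i : exact u [::] i.+1.
Proof.
move=> v; rewrite !dmask_slice_nil => vu vc.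
have [|w wu ->] := strand_exact vu.
  by rewrite -(below_scalar_dif vu) -dmask_slice_nil.
by exists w; rewrite ?dmask_slice_nil ?below_scalar_dif.
Qed.

Lemma exact_covered u i : covered B u -> exact u [::] i.
Proof.
case: i => [cu v | i _]; last exact: strand_exact_at.
rewrite !dmask_slice_nil => vu _.
have [|w wu ->] := (strand_augP vu).2; first by right.
by exists w; rewrite ?dmask_slice_nil ?below_scalar_dif.
Qed.

Lemma not_exact_uncovered u : ~~ covered B u -> ~ exact u [::] 0%N.
Proof.
move=> cu ex; have [v vu v1] := strand_aug_surj cu.
have [||w] := ex v; rewrite ?dmask_slice_nil // => wu vE.
have [|/eqP|] := (strand_augP vu).1; rewrite ?v1 ?oner_eq0 ?(negbTE cu) //.
by exists w => //; rewrite {1}vE below_scalar_dif.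
Qed.

Lemma below_sub u s i (v : 'rV[K]_(rk F i)) :
  supp_below (u - U_(s))%MM v -> supp_below u v.
Proof.
move=> vu; apply/dmaskP=> k ku; have /dmaskP-> // := vu.
by apply: contra ku => /lepm_trans; apply; apply: lem_subr.
Qed.

(** Multiplication by x_s is an isomorphism from degree [u - U_(s)] to degree [u] of R/J, so the
    quotient of the two strands is exact. Degrees 0 and 1 involve the augmentation and are treated
    by hand. *)
Lemma exact_removable1 u s i : u s != 0%N ->
  covered B u = covered B (u - U_(s))%MM -> exact u [:: s] i.
Proof.
move=> us cE; have sl : s \notin [::] by [].
case: i => [|[|i]]; last first.
- by apply: exact_slice_quo => // [|_ [<-]]; apply: strand_exact_at.
- move=> v vs vc; apply: (slice_boundary_quo sl us vs).
  have vu : supp_below u v.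
    by apply/dmaskP=> k ku; have /dmaskP-> // := vs; rewrite /slice negb_and ku.
  have yu : supp_below (u - U_(s))%MM (v *m D 0).
    apply/dmaskP=> k ku; case kl: (slice u [:: s] (deg k)).
      have /rowP/(_ k) : v *m D 0 *m dmask K (@bdeg K n F) (slice u [:: s]) 0 = 0 := vc.
      by rewrite dmaskE kl [RHS]mxE.
    have /dmaskP-> // := below_scalar_dif vu; apply: contra ku => ku.
    have := slice_step (deg k) sl us; rewrite kl addbF !slice_nil => <-.
    exact: ku.
  (* Injectivity of multiplication by x_s: the boundary of [v] already bounds some [w] in the
     smaller strand, and [v - w] is a cycle. *)
  have [|w wu wE] := (strand_augP yu).2.
    by rewrite -cE; apply/(strand_augP (below_scalar_dif vu)); exists v.
  exists w; first by rewrite dmask_slice_nil.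
  have wu' := below_sub wu.
  have [||z zu zE] := strand_exact (u := u) (v := v - w).
  - by rewrite mulmxBl vu wu'.
  - by rewrite mulmxBl wE subrr.
  exists z; rewrite dmask_slice_nil // zE.
  by rewrite below_scalar_dif.
move=> v vs _; apply: (slice_boundary_quo sl us vs).
have vu : supp_below u v.
  by apply/dmaskP=> k ku; have /dmaskP-> // := vs; rewrite /slice negb_and ku.
(* Surjectivity: a chain [w] of the smaller strand with the same augmentation as [v], unless [u] is
   covered. *)
suff [w wu wE] : exists2 w, supp_below (u - U_(s))%MM w &
    scalar_aug (v - w) = 0 \/ covered B u.
  exists w; first by rewrite dmask_slice_nil.
  have [|z zu zE] := (strand_augP (u := u) (v := v - w) _).2 wE.
    by rewrite mulmxBl vu (below_sub wu).
  exists z; rewrite dmask_slice_nil // zE.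
  by rewrite below_scalar_dif.
case cu: (covered B u); first by exists 0; [rewrite mul0mx | right].
have [|w wu w1] := @strand_aug_surj (u - U_(s))%MM; first by rewrite -cE cu.
exists (scalar_aug v *: w); first by rewrite -scalemxAl wu.
left; rewrite -[RHS](subrr (scalar_aug v)) -[X in _ = _ - X]mulr1 -w1.
rewrite mulr_sumr -sumrB; apply: eq_bigr => k _.
by rewrite !mxE mulrBl mulrA.
Qed.

(** Removability of [s] passes to [u - U_(e)] for [e] other than [s], so exactness for [[:: s]]
    propagates through the quotients; [rcons] makes [[:: s]] the base of the induction. *)
Lemma exact_removable u l s i : removable u s -> exact u (rcons l s) i.
Proof.
elim: l u i => [|e l IH] u i us.
  have [us0 usE] := us; apply: exact_removable1 => //.
  by apply: usE => //; apply: lepm_refl.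
rewrite rcons_cons.
case eu: ((e \in rcons l s) || (u e == 0%N)).
  by apply: exact_at_slice_mem => //; apply: IH.
move/norP: (negbT eu) => [el ue].
apply: exact_slice_quo => // [|j _]; apply: IH => //.
have es : (e == s) = false.
  by apply: contraNF el => /eqP->; rewrite mem_rcons mem_head.
have [us0 usE] := us.
have uE : (u - U_(e))%MM s = u s by rewrite mnmBE mnm1E es subn0.
split=> [|v vu]; rewrite uE //; apply: usE.
by apply: lepm_trans vu (lem_subr _ _).
Qed.

(** By minimality the differential vanishes on a single degree, so exactness there means that the
    degree carries no basis element. *)
Lemma exact_degreeP u i :
  exact_at (@bdeg K n F) D (pred1 u) i <-> ~ res_mdeg F i u.
Proof.
split=> [ex [k ku] | nu v vu _].
  have [||w wu] := ex (delta_mx 0 k).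
  - apply/dmaskP=> j; rewrite mxE eqxx /=; case: (eqVneq j k) => // ->.
    by rewrite ku eqxx.
  - case: i k ku ex => //= i k ku ex; rewrite -rowE; apply/rowP=> j.
    rewrite dmaskE [RHS]mxE /=; case: eqP => // ju.
    by rewrite mxE scalar_dif_min // ku.
  move/rowP/(_ k); rewrite dmaskE /= ku eqxx mxE !eqxx mxE big1.
    by move/eqP; rewrite oner_eq0.
  move=> j _; case: (eqVneq (deg j) u) => ju.
    by rewrite scalar_dif_min ?mulr0 // ku.
  by have /dmaskP-> := wu; rewrite ?mul0r.
exists 0; rewrite ?mul0mx //; apply/rowP=> k; rewrite [RHS]mxE.
by have /dmaskP-> // := vu; apply/eqP=> ku; apply: nu; exists k.
Qed.

Lemma slice_full u l : (forall i, u i != 0%N -> i \in l) ->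
  slice u l =1 pred1 u.
Proof.
move=> ul v; apply/andP/eqP => [[/mnm_lepP vu /allP vl]|->].
  apply/mnmP=> i; case: (eqVneq (u i) 0%N) => [ui|/ul/vl/eqP //].
  by have := vu i; rewrite ui leqn0 => /eqP->.
by rewrite lepm_refl; split=> //; apply/allP.
Qed.

Lemma res_mdeg_not_removable u s i : removable u s -> ~ res_mdeg F i u.
Proof.
move=> us; apply/exact_degreeP.
apply: (eq_exact_at (slice_full (l := rcons (enum 'I_n) s) _)).
  by move=> j _; rewrite mem_rcons inE mem_enum orbT.
exact: exact_removable.
Qed.

(** Lowering an exponent that is at least 2 keeps the support; hence the multidegrees of the
    resolution are squarefree. *)
Lemma removable_ge2 u s : (1 < u s)%N -> removable u s.
Proof.
move=> us; split=> [|v vu vs]; first by case: (u s) us.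
rewrite /covered; apply: eq_forallb_in => E _; rewrite !meetsE.
suff -> : msup (v - U_(s))%MM = msup v by [].
apply/setP=> i; rewrite !inE mnmBE mnm1E; case: (eqVneq s i) => [<-|_].
  by rewrite vs; case: (u s) us => [|[]].
by rewrite subn0.
Qed.

(** * The matroid case: locating the homology of squarefree slices *)

Hypothesis matB : is_matroid_bases B.
Let B0 : B != set0. Proof. by case: matB. Qed.
Let exch : forall B1 B2, B1 \in B -> B2 \in B ->
  forall x, x \in B1 :\: B2 ->
    exists2 y, y \in B2 :\: B1 & (B1 :\ x) :|: [set y] \in B.
Proof. by case: matB. Qed.

Local Notation g := (cover_number B).

(** If removing [s] lowered [g] on the support of some [v] below [mset A], supermodularity would
    make it lower [g A] as well. *)
Lemma removable_mset (A : {set 'I_n}) s : s \in A -> g (A :\ s) = g A ->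
  removable (mset A) s.
Proof.
move=> sA gA; split=> [|v vA vs]; first by rewrite mnmE sA.
rewrite !covered_cover_number //.
have -> : msup (v - U_(s))%MM = msup v :\ s.
  apply/setP=> i; rewrite !inE mnmBE mnm1E (eq_sym s i).
  case: (eqVneq i s) => [->|_]; last by rewrite subn0.
  by rewrite vs mnmE sA.
have sv : s \in msup v by rewrite inE vs mnmE sA.
have vA' : msup v \subset A.
  apply/subsetP=> i; rewrite inE; have := mnm_lepP vA i; rewrite mnmE.
  by case: (i \in A) => //; rewrite leqn0 => ->.
have := cover_numberS B0 (subD1set (msup v) s).
rewrite leq_eqVlt => /predU1P[-> // | /(cover_number_supmod B0 exch vA' sv)].
by rewrite gA => /n_Sn.
Qed.

(* The homology is Tor_i(R/(J : x^T), K) in degree x^l: a contraction by T. *)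
Lemma exact_mset l (A : {set 'I_n}) : uniq l -> {subset l <= A} ->
  let T := A :\: [set x in l] in
  [/\ (0 < g T)%N -> forall i, exact (mset A) l i,
      g T = 0%N -> forall i, i <> g A -> exact (mset A) l i &
      g T = 0%N -> (forall s, s \in l -> g A = (g (A :\ s)).+1) ->
        ~ exact (mset A) l (g A)].
Proof.
elim: l A => [|e l IH] A.
  move=> _ _ T; have -> : T = A by apply/setP=> x; rewrite !inE.
  split=> [gA i|gA [|i] gi|gA _]; last rewrite gA.
  - by apply: exact_covered; rewrite covered_cover_number // msup_mset.
  - by rewrite gA in gi.
  - exact: strand_exact_at.
  - by apply: not_exact_uncovered; rewrite covered_cover_number // msup_mset gA.
move=> /= /andP[el ul] elA.
have eA : e \in A by apply: elA; rewrite mem_head.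
have lA : {subset l <= A} by move=> x xl; apply: elA; rewrite inE xl orbT.
have lAe : {subset l <= A :\ e}.
  by move=> x xl; rewrite !inE lA // andbT; apply: contraNneq el => <-.
pose T := A :\: [set x in l].
have eT : e \in T by rewrite !inE el eA.
have sTA : T \subset A by apply: subsetDl.
have -> : A :\: [set x in e :: l] = T :\ e.
  by apply/setP=> x; rewrite !inE negb_or andbA.
have [] := IH A ul lA; rewrite -/T => exA1 exA2 exA3.
have [] := IH (A :\ e) ul lAe.
have -> : A :\ e :\: [set x in l] = T :\ e.
  by apply/setP=> x; rewrite !inE andbCA.
rewrite -mset_sub1 => exE1 exE2 exE3.
have ue : mset A e != 0%N by rewrite mnmE eA.
have gTe : (g (T :\ e) <= g T)%N by apply/cover_numberS/subD1set.
split=> [gT i | gT i iA | gT nocol].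
- by apply: exact_slice_quo => // [|j _]; [apply: exA1; apply: leq_trans gTe | apply: exE1].
(* Either [e] is removable and the slice is exact, or [g] drops by one at [e], matching the shift of
   the connecting map. *)
- case: (eqVneq (g (A :\ e)) (g A)) => gAe.
    have /exact_removable rem := removable_mset eA gAe.
    by apply: eq_exact_at (rem l i) => v; rewrite /slice all_rcons.
  have {}gAe : g A = (g (A :\ e)).+1.
    apply/eqP; rewrite eqn_leq cover_numberD1 // ltn_neqAle gAe /=.
    exact/cover_numberS/subD1set.
  apply: exact_slice_quo => // [|j ij]; last first.
    by apply: exE2 => // jA; apply: iA; rewrite ij gAe jA.
  by case: (posnP (g T)) => [/exA2|/exA1]; apply.
have gAe := nocol e (mem_head _ _).
have nocol_l s : s \in l -> g A = (g (A :\ s)).+1.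
  by move=> sl; apply: nocol; rewrite inE sl orbT.
(* If [g T = 0], the slice of [A :\ e] is exact at [g A], so the nonzero homology of the slice for
   [l] survives in the quotient. *)
case: (posnP (g T)) => gT'.
  move=> ex; apply: (exA3 gT' nocol_l).
  refine (exact_slice_ext el ue _ ex).
  by apply: exE2 => //; rewrite gAe => /eqP; rewrite eqn_leq ltnn.
(* If [g T > 0], the slice for [l] is exact and the connecting map carries the homology to [A :\ e].
   Since [g] drops at [e] on [T], it drops at [e] on [A :\ s], which gives the hypothesis for
   [A :\ e]. *)
rewrite gAe => ex; apply: (exE3 gT) => [s sl|].
  have gAs := cover_number_supmod B0 exch (A := A :\ s) (A' := T) (x := e).
  have sTAs : T \subset A :\ s.
    apply/subsetP=> x; rewrite !inE => /andP[xl ->]; rewrite andbT.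
    by apply: contraNneq xl => ->.
  have {}gAs := gAs sTAs eT; rewrite gT in gAs; have {}gAs := gAs gT'.
  apply: succn_inj; rewrite -gAe (nocol_l s sl) gAs; congr _.+2.
  by congr (g _); apply/setP=> x; rewrite !inE andbCA.
by refine (exact_slice_sub el ue ex _); apply: exA1.
Qed.

(** With [l] listing all of [A], the set [T] is empty: homology can occur only at [g A], and does
    when no element of [A] is removable. *)
Lemma res_mdegE h m : res_mdeg F h m <->
  exists2 A, m = mset A &
    h = g A /\ forall x, x \in A -> g A = (g (A :\ x)).+1.
Proof.
have A0 (A : {set 'I_n}) : g (A :\: [set x in enum A]) = 0%N.
  rewrite (_ : _ :\: _ = set0) ?cover_number0 //.
  by apply/setP=> x; rewrite !inE mem_enum andNb.
have mE (A : {set 'I_n}) i : exact (mset A) (enum A) i <-> ~ res_mdeg F i (mset A).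
  rewrite -exact_degreeP; have sl : slice (mset A) (enum A) =1 pred1 (mset A).
    by apply: slice_full => j; rewrite mnmE mem_enum; case: (j \in A).
  by split; apply: eq_exact_at => // x; rewrite sl.
have exA (A : {set 'I_n}) := @exact_mset (enum A) A (enum_uniq _).
have sub (A : {set 'I_n}) : {subset enum A <= A} by move=> x; rewrite mem_enum.
split=> [hm | [A -> [-> Acol]]].
  have mA : m = mset (msup m).
    apply/esym/mset_msup/forallP=> s; rewrite leqNgt; apply/negP=> ms.
    exact: res_mdeg_not_removable (removable_ge2 ms) hm.
  exists (msup m) => //; move: (msup m) mA hm => A -> hm.
  split=> [|x xA]; last first.
    apply/eqP; rewrite eqn_leq cover_numberD1 //= ltn_neqAle cover_numberS ?subD1set //.
    rewrite andbT; apply/eqP=> /(removable_mset xA) rem.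
    exact: res_mdeg_not_removable rem hm.
  apply: NNPP => hA; have [_ /(_ (A0 A) h hA) ex _] := exA A (sub A).
  by move/mE: ex; apply.
apply: NNPP => /mE ex; have [_ _ /(_ (A0 A)) nex] := exA A (sub A).
by apply: nex ex => s; rewrite mem_enum; apply: Acol.
Qed.

End Strands.

Theorem theorem5p3 (K : fieldType) (n : nat) (B : {set {set 'I_n}})
  (hB : is_matroid_bases B) (F : mfree_complex K n)
  (hF : is_min_mgraded_free_resolution (cover_ideal (K:=K) B) F) (h : nat) :
  (1 <= h)%N ->
  forall m : 'X_{1..n}, min_gens (SF (cover_ideal (K:=K) B) h) m <-> res_mdeg F h m.
Proof.
move=> h1 m; have [B0 exch] := hB.
rewrite min_gens_SF // (res_mdegE hF hB).
split=> -[A ->]; first move=> [hA Amin]; last move=> [-> Acol]; exists A => //.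
  (* Removing one element lowers the cover number by at most one, and to below [h], so it cannot
     exceed [h]. *)
  have step x (xA : x \in A) := leq_trans (cover_numberD1 B0 A x) (Amin x xA).
  have gA : h = cover_number B A.
    apply/eqP; rewrite eqn_leq hA /=.
    have [A0|[x xA]] := set_0Vmem A; last exact: step xA.
    by rewrite A0 cover_number0.
  split=> // x xA; apply/eqP; rewrite eqn_leq cover_numberD1 //=.
  by rewrite -gA Amin.
by split=> // x xA; rewrite (Acol x xA).
Qed.
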